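(* Let $k\ge 0$ be an integer and let $I\subseteq R=\mathbb{K}[x_1,\dots,x_n]$ be a $k$-decomposable monomial ideal with shedding monomial $u$, meaning that $u$ is a shedding monomial for $I$ with $|\mathrm{supp}(u)|\le k+1$ such that $I_u$ and $I^u$ are $k$-decomposable. Put $m=|\mathrm{supp}(u)|$. Then for all $i,j$, $$\beta_{i,j}(I)=\beta_{i,j}(I^u)+\sum_{l=0}^m \binom{m}{l}\, \beta_{i-l,j-l}(I_u).$$
   Context: $\mathbb{K}$ is a field and $R=\mathbb{K}[x_1,\dots,x_n]$ is standard graded. $\beta_{i,j}(M)$ denotes the $(i,j)$-th graded Betti number of a finitely generated graded $R$-module $M$, i.e. $\beta_{i,j}(M)=\dim_{\mathbb{K}}\mathrm{Tor}_i^R(M,\mathbb{K})_j$ (zero for $i<0$). For a monomial ideal $I$, $\mathcal{G}(I)$ is its unique set of minimal monomial generators. For a monomial $u=x_1^{a_1}\cdots x_n^{a_n}$, $\mathrm{supp}(u)=\{x_i: a_i\neq 0\}$. For a monomial $M$, write $[u,M]=1$ if $x_i^{a_i}\nmid M$ for all $x_i\in\mathrm{supp}(u)$; otherwise write $[u,M]\ne 1$. For a monomial ideal $I$ define $$I^u=(M\in\mathcal{G}(I): [u,M]\neq 1),\qquad I_u=(M\in\mathcal{G}(I): [u,M]=1).$$ A monomial $u$ is a shedding monomial for $I$ if $I_u\ne 0$ and for each $M_i\in\mathcal{G}(I_u)$ and each $x_\ell\in\mathrm{supp}(u)$ there exists $M_j\in\mathcal{G}(I^u)$ such that $M_j:M_i=x_\ell$,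 where $M_j:M_i=M_j/\gcd(M_j,M_i)$ is the monomial generating the colon ideal $(M_j):(M_i)$. A monomial ideal $I$ with $\mathcal{G}(I)=\{M_1,\dots,M_r\}$ is called $k$-decomposable (recursive definition) if $r=1$, or else $I$ has a shedding monomial $u$ with $|\mathrm{supp}(u)|\le k+1$ such that the ideals $I_u$ and $I^u$ are $k$-decomposable. *)

(* Defs.v *)
From HB Require Import structures.
From mathcomp Require Import all_boot all_order all_algebra.
From mathcomp.multinomials Require Export mpoly.
From Stdlib Require Import ClassicalEpsilon.

Set Implicit Arguments.
Unset Strict Implicit.
Unset Printing Implicit Defensive.

Import GRing.Theory.
Local Open Scope ring_scope.

(* Ideals of K[x_1,..,x_n] are Prop-valued predicates on {mpoly K[n]}; a
   monomial is its exponent vector m : 'X_{1..n}, the polynomial being 'X_[m],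
   and (m1 <= m2)%MM is divisibility. *)

Section MonomialIdeals.
Context {K : fieldType} {n : nat}.
Implicit Types (I : {mpoly K[n]} -> Prop) (u M : 'X_{1..n}).

Definition ideal_of_monomials (S : 'X_{1..n} -> Prop) : {mpoly K[n]} -> Prop :=
  fun f => exists (r : nat) (c : 'I_r -> {mpoly K[n]}) (M : 'I_r -> 'X_{1..n}),
    (forall t, S (M t)) /\ f = \sum_(t < r) c t * 'X_[M t].

Definition monomial_ideal I : Prop :=
  exists S : 'X_{1..n} -> Prop, forall f, I f <-> ideal_of_monomials S f.

Definition min_gen I M : Prop :=
  I 'X_[M] /\ (forall M', I 'X_[M'] -> (M' <= M)%MM -> M' = M).

Definition supp u : {set 'I_n} := [set i | u i != 0%N].

Definition bracket_eq1 u M : bool :=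
  [forall i in supp u, ~~ ((U_(i) *+ u i)%MM <= M)%MM].

Definition ideal_upper u I : {mpoly K[n]} -> Prop :=
  ideal_of_monomials (fun M => min_gen I M /\ ~~ bracket_eq1 u M).

Definition ideal_lower u I : {mpoly K[n]} -> Prop :=
  ideal_of_monomials (fun M => min_gen I M /\ bracket_eq1 u M).

Definition mgcd M1 M2 : 'X_{1..n} := [multinom minn (M1 i) (M2 i) | i < n].

Definition mcolon M1 M2 : 'X_{1..n} := (M1 - mgcd M1 M2)%MM.

Definition shedding_monomial u I : Prop :=
  (exists2 f, ideal_lower u I f & f <> 0) /\
  (forall M l, min_gen (ideal_lower u I) M -> l \in supp u ->
     exists2 M', min_gen (ideal_upper u I) M' & mcolon M' M = U_(l)%MM).

Inductive k_decomposable (k : nat) I : Prop :=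
| KDecPrincipal of monomial_ideal I &
    (exists M0, forall M, min_gen I M <-> M = M0)
| KDecShedding u of monomial_ideal I & shedding_monomial u I &
    (#|supp u| <= k.+1)%N &
    k_decomposable k (ideal_lower u I) & k_decomposable k (ideal_upper u I).

Definition homogeneous_of (d : int) (p : {mpoly K[n]}) : Prop :=
  forall m, m \in msupp p -> (mdeg m)%:Z = d.

(* A graded free resolution ... -> F_1 -> F_0 -> I -> 0 by modules of finite
   rank, where F_i is the direct sum over b of R(- gdeg i b). Elements of F_i
   are row vectors and maps act by right multiplication. *)
Record gfree_resolution I := GFreeResolution {
  frank : nat -> nat;
  gdeg : forall i, 'I_(frank i) -> int;
  fdiff : forall i, 'M[{mpoly K[n]}]_(frank i.+1, frank i);
  faug : 'cV[{mpoly K[n]}]_(frank 0);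
  fdiff_homog : forall i a b,
    homogeneous_of (gdeg a - gdeg b) (fdiff i a b);
  faug_homog : forall b, homogeneous_of (gdeg b) (faug b 0);
  faug_image : forall f, I f <-> exists v : 'rV_(frank 0), (v *m faug) 0 0 = f;
  fexact0 : forall v : 'rV_(frank 0),
    v *m faug = 0 <-> exists w, v = w *m fdiff 0;
  fexactS : forall i (v : 'rV_(frank i.+1)),
    v *m fdiff i = 0 <-> exists w, v = w *m fdiff i.+1
}.

Section Tor.
Variables (I : {mpoly K[n]} -> Prop) (F : gfree_resolution I).

(* The complex F tensored with K = R/(x_1,..,x_n): the residue map R -> K takes
   the constant coefficient, and K (x) F_i = K^(frank F i). *)
Definition tor_diff i : 'M[K]_(frank F i.+1, frank F i) :=
  map_mx (mcoeff 0%MM) (fdiff F i).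

Definition tor_cycles i : 'M[K]_(frank F i) :=
  match i with
  | 0 => 1%:M
  | i'.+1 => kermx (tor_diff i')
  end.

Definition deg_part i (j : int) : 'M[K]_(frank F i) :=
  diag_mx (\row_b (gdeg b == j)%:R).

(* dim_K Tor_i(I, K)_j as dim Z_j - dim B_j; the subtraction is not truncated
   since boundaries are cycles. *)
Definition tor_dim i (j : int) : nat :=
  (\rank (tor_cycles i :&: deg_part i j)%MS
     - \rank (tor_diff i :&: deg_part i j)%MS)%N.

End Tor.

(* Tor does not depend on the resolution, so epsilon selects the only value
   satisfying the predicate. *)
Definition betti I (i j : int) : nat :=
  match i with
  | Posz p => epsilon (inhabits 0%N)
                (fun d => exists F : gfree_resolution I, d = tor_dim F p j)
  | Negz _ => 0%N
  end.

End MonomialIdeals.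

(* Main.v *)
Require Import Defs.
From mathcomp Require Import all_boot all_order all_algebra.
From mathcomp Require Import zify ring.
From Stdlib Require Import ClassicalEpsilon.

(** The ideal I and its upper and lower ideals all have linear quotients, and the
    Betti numbers of an ideal with linear quotients can be read off its colon
    ideals; the recursion is then an identity between binomial coefficients.

    A k-decomposable ideal has linear quotients: its minimal generators can be
    ordered so that the ideal of the generators before M, colon M, is generated
    by a set S(M) of variables ([k_decomposable_linear_quotients]). For a
    shedding monomial u the order lists an order for the upper ideal and then
    one for the lower ideal. If M generates the lower ideal, the shedding
    condition forces the exponent of M at every x_l in supp u to be exactly one
    less than that of u ([shedding_colon_le]). Hence the upper ideal colon M is
    generated by the variables of supp u, while colons between generators of
    the lower ideal do not involve these variables. So S(M) grows by exactly the
    m = #|supp u| variables of supp u when M is viewed in the whole ideal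
    ([shedding_presents]).

    For an ideal with linear quotients, Tor_i in degree j has dimension
      sum over M of C(|S(M)|, i) [j = i + deg M]
    ([betti_linear_quotients]). Adjoining a generator M is a mapping cone: the
    resolution of the earlier ideal and the resolution of the ideal of the
    variables S(M), shifted by deg M, glue to a resolution of the larger ideal
    ([mapping_cone]); the ideal of variables is itself resolved in this way.
    If the generators come in order of nondecreasing degree, the comparison map
    in the cone has no constant entries, for degree reasons, so the resolution
    stays minimal and its ranks are the Betti numbers. A linear quotient order
    can always be sorted by degree without changing the sets S(M)
    ([linear_quotients_swap]). That the Betti numbers may be computed from this
    particular resolution is the comparison theorem: chain maps lift the
    identity, and compositions of lifts are homotopic to the identity
    ([tor_dim_unique]).

    With these formulas the theorem compares C(|S(M)| + m, i) with the sum over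
    l of C(m, l) C(|S(M)|, i - l), which is Vandermonde's identity. *)

Set Implicit Arguments.
Unset Strict Implicit.
Unset Printing Implicit Defensive.

Import GRing.Theory.

(** * Homogeneous components *)

Section Homogeneous.
Local Open Scope ring_scope.
Context {K : fieldType} {n : nat}.
Implicit Types (p q f : {mpoly K[n]}) (m M : 'X_{1..n}) (d e : int).

Lemma homogeneousP d p :
  homogeneous_of d p <-> forall m, (mdeg m)%:Z != d -> p@_m = 0.
Proof.
split=> [hp m | hp m].
  by apply: contra_neq_eq; rewrite -mcoeff_msupp => /hp.
by rewrite mcoeff_msupp => /eqP pm; apply/eqP/negPn/negP=> /hp.
Qed.

Lemma homogeneous0 d : homogeneous_of d (0 : {mpoly K[n]}).
Proof. by move=> m; rewrite msupp0. Qed.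

Lemma homogeneousD d p q :
  homogeneous_of d p -> homogeneous_of d q -> homogeneous_of d (p + q).
Proof. by move=> hp hq m /msuppD_le; rewrite mem_cat => /orP [/hp|/hq]. Qed.

Lemma homogeneousN d p : homogeneous_of d p -> homogeneous_of d (- p).
Proof. by move=> hp m; rewrite (perm_mem (msuppN _)) => /hp. Qed.

Lemma homogeneousM d e p q :
  homogeneous_of d p -> homogeneous_of e q -> homogeneous_of (d + e) (p * q).
Proof.
move=> hp hq m /msuppM_le /allpairsP [[m1 m2] /= [/hp <- /hq <- ->]].
by rewrite mdegD PoszD.
Qed.

Lemma homogeneous_sum (T : Type) (r : seq T) (P : pred T) d
    (F : T -> {mpoly K[n]}) :
  (forall t, P t -> homogeneous_of d (F t)) ->
  homogeneous_of d (\sum_(t <- r | P t) F t).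
Proof.
move=> hF; apply: (big_ind (homogeneous_of d)) => //.
- exact: homogeneous0.
- exact: homogeneousD.
Qed.

Lemma homogeneousX M : homogeneous_of (mdeg M)%:Z ('X_[M] : {mpoly K[n]}).
Proof. by move=> m /mem_msuppXP <-. Qed.

Lemma homogeneous_mcoeff0 d p : homogeneous_of d p -> d != 0 -> p@_0%MM = 0.
Proof.
by move=> /homogeneousP hp d0; apply: hp; rewrite mdeg0 eq_sym.
Qed.

(** Degrees are integers because the degree of a matrix entry is a difference
    of degrees of basis elements, which may be negative. *)
Definition hcomp d p : {mpoly K[n]} :=
  \sum_(m <- msupp p | (mdeg m)%:Z == d) p@_m *: 'X_[m].

Lemma mcoeff_hcomp d p m :
  (hcomp d p)@_m = if (mdeg m)%:Z == d then p@_m else 0.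
Proof.
rewrite /hcomp raddf_sum /=.
under eq_bigr do rewrite mcoeffZ mcoeffX.
case: ifP => hm; last first.
  apply: big1 => m' hm'; case: eqP => [E|]; last by rewrite mulr0.
  by rewrite -E hm' in hm.
have [mp|mp] := boolP (m \in msupp p).
  rewrite -big_filter (bigD1_seq m) ?mem_filter ?hm ?filter_uniq ?msupp_uniq //=.
  rewrite eqxx mulr1 big1 ?addr0 // => m' /negPf ->; exact: mulr0.
rewrite big_seq_cond big1 ?memN_msupp_eq0 // => m' /andP [m'p _].
case: eqP => [E|]; last by rewrite mulr0.
by rewrite -E m'p in mp.
Qed.

Lemma homogeneous_hcomp d p : homogeneous_of d (hcomp d p).
Proof. by apply/homogeneousP=> m; rewrite mcoeff_hcomp => /negPf ->. Qed.

Lemma hcompD d : {morph hcomp d : p q / p + q}.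
Proof.
move=> p q; apply/mpolyP=> m; rewrite mcoeffD !mcoeff_hcomp mcoeffD.
by case: ifP; rewrite ?addr0.
Qed.

Lemma hcomp0 d : hcomp d 0 = 0.
Proof. by apply/mpolyP=> m; rewrite mcoeff_hcomp mcoeff0 if_same. Qed.

Lemma hcomp_id d p : homogeneous_of d p -> hcomp d p = p.
Proof.
move/homogeneousP=> hp; apply/mpolyP=> m; rewrite mcoeff_hcomp.
by case: eqP => // /eqP /hp ->.
Qed.

(** Multiplication by a homogeneous factor shifts components; this is what
    allows a homogeneous equation to be solved by homogeneous unknowns. *)
Lemma hcompMr d e p q :
  homogeneous_of e q -> hcomp d (p * q) = hcomp (d - e) p * q.
Proof.
move=> hq; set p1 := hcomp _ p.
have -> : p * q = p1 * q + (p - p1) * q by ring.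
rewrite hcompD [hcomp d (p1 * q)]hcomp_id; last first.
  by rewrite -[d](subrK e); apply: homogeneousM => //; apply: homogeneous_hcomp.
rewrite -[RHS]addr0; congr (_ + _); apply/mpolyP=> m.
rewrite mcoeff0 mcoeff_hcomp; case: eqP => // hm.
apply: memN_msupp_eq0.
apply/negP => /msuppM_le /allpairsP [[m1 m2] /= [h1 /hq h2 E]].
move: h1; rewrite mcoeff_msupp mcoeffB mcoeff_hcomp.
have -> : (mdeg m1)%:Z == d - e; last by rewrite subrr eqxx.
by rewrite -hm E mdegD PoszD h2 addrK.
Qed.

Lemma hcomp_sum d (T : Type) (r : seq T) (F : T -> {mpoly K[n]}) :
  hcomp d (\sum_(t <- r) F t) = \sum_(t <- r) hcomp d (F t).
Proof. by apply: (big_morph _ (hcompD d) (hcomp0 d)). Qed.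

Definition homog_mx r c (dr : 'I_r -> int) (dc : 'I_c -> int)
    (A : 'M[{mpoly K[n]}]_(r, c)) :=
  forall a b, homogeneous_of (dr a - dc b) (A a b).

Lemma homog_mxM r s c (dr : 'I_r -> int) (ds : 'I_s -> int) (dc : 'I_c -> int)
    A B :
  homog_mx dr ds A -> homog_mx ds dc B -> homog_mx dr dc (A *m B).
Proof.
move=> hA hB a b; rewrite mxE; apply: homogeneous_sum => t _.
have -> : dr a - dc b = (dr a - ds t) + (ds t - dc b) by ring.
exact: homogeneousM.
Qed.

Lemma homog_mxD r c (dr : 'I_r -> int) (dc : 'I_c -> int) A B :
  homog_mx dr dc A -> homog_mx dr dc B -> homog_mx dr dc (A + B).
Proof. by move=> hA hB a b; rewrite mxE; apply: homogeneousD. Qed.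

Lemma homog_mxN r c (dr : 'I_r -> int) (dc : 'I_c -> int) A :
  homog_mx dr dc A -> homog_mx dr dc (- A).
Proof. by move=> hA a b; rewrite mxE; apply: homogeneousN. Qed.

Lemma homog_mx1 r (dr : 'I_r -> int) : homog_mx dr dr 1%:M.
Proof.
move=> a b; rewrite mxE; case: eqP => [->|_]; last exact: homogeneous0.
by rewrite subrr => m; rewrite /= msupp1 inE => /eqP ->; rewrite mdeg0.
Qed.

(** Rows lift one by one, in a non-homogeneous way; cutting each entry of the
    lift down to its component of the expected degree preserves the equation,
    because both A and D are homogeneous. *)
Lemma homog_lift r s c (dr : 'I_r -> int) (ds : 'I_s -> int) (dc : 'I_c -> int)
    (A : 'M[{mpoly K[n]}]_(r, c)) (D : 'M_(s, c)) :
    homog_mx dr dc A -> homog_mx ds dc D ->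
    (forall a, exists w, row a A = w *m D) ->
  exists2 W, homog_mx dr ds W & A = W *m D.
Proof.
move=> hA hD liftA.
have [W0 hW0] : exists W0 : 'I_r -> 'rV_s, forall a, row a A = W0 a *m D.
  exists (fun a => sval (constructive_indefinite_description _ (liftA a))) => a.
  by case: (constructive_indefinite_description _ _).
exists (\matrix_(a, b) hcomp (dr a - ds b) (W0 a 0 b)) => [a b|].
  by rewrite mxE; apply: homogeneous_hcomp.
apply/matrixP=> a c'; rewrite -[LHS](hcomp_id (hA a c')).
move/rowP/(_ c'): (hW0 a); rewrite !mxE => ->.
rewrite hcomp_sum; apply: eq_bigr => b _; rewrite (hcompMr _ _ (hD b c')) !mxE.
by congr (hcomp _ _ * _); ring.
Qed.

End Homogeneous.

(** * Chain maps and homotopies between graded free resolutions *)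

(** Sequences of matrices whose sizes vary with the index are built one term
    at a time; P is the invariant that makes the next step possible. *)
Lemma dependent_choice (T : nat -> Type) (P : forall i, T i -> Prop)
    (Q : forall i, T i -> T i.+1 -> Prop) (a : T 0%N) :
    P 0%N a -> (forall i x, P i x -> exists2 y, P i.+1 y & Q i x y) ->
  exists f : forall i, T i,
    f 0%N = a /\ forall i, P i (f i) /\ Q i (f i) (f i.+1).
Proof.
move=> Pa step.
have nxt i (x : {x : T i | P i x}) :
    {y : {y : T i.+1 | P i.+1 y} | Q i (sval x) (sval y)}.
  apply: constructive_indefinite_description.
  by case: x => x Px; have [y Py Qxy] := step i x Px; exists (exist _ y Py).
pose f := fix f i : {x : T i | P i x} :=
  if i is i'.+1 then sval (nxt i' (f i')) else exist _ a Pa.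
exists (fun i => sval (f i)); split=> // i.
by split; [apply: svalP | apply: (svalP (nxt i (f i)))].
Qed.

Section Comparison.
Local Open Scope ring_scope.
Context {K : fieldType} {n : nat}.
Implicit Types (I L : {mpoly K[n]} -> Prop).

(** The augmented complex, with R itself placed in index 0. With this
    convention the augmentation is one more differential, exactness holds in
    every index above 0, and lifting arguments need no separate initial case.
    *)
Definition arank I (F : gfree_resolution I) i :=
  if i is i'.+1 then frank F i' else 1%N.

Definition adeg I (F : gfree_resolution I) i : 'I_(arank F i) -> int :=
  match i with 0 => fun _ => 0 | i'.+1 => @gdeg _ _ _ F i' end.

Definition adiff I (F : gfree_resolution I) i :
    'M[{mpoly K[n]}]_(arank F i.+1, arank F i) :=
  match i with 0 => faug F | i'.+1 => fdiff F i' end.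

Lemma homog_adiff I (F : gfree_resolution I) i :
  homog_mx (@adeg I F i.+1) (@adeg I F i) (adiff F i).
Proof.
case: i => [|i] a b /=; last exact: fdiff_homog.
by rewrite subr0 ord1; apply: faug_homog.
Qed.

Lemma adiff_exact I (F : gfree_resolution I) i (v : 'rV_(arank F i.+1)) :
  v *m adiff F i = 0 <-> exists w, v = w *m adiff F i.+1.
Proof. by case: i v => [|i] v; [apply: fexact0 | apply: fexactS]. Qed.

Lemma adiff_comp I (F : gfree_resolution I) i : adiff F i.+1 *m adiff F i = 0.
Proof.
apply/row_matrixP=> a; rewrite row_mul row0.
by apply/adiff_exact; exists (delta_mx 0 a); rewrite rowE.
Qed.

(** Multiplication by f maps L to I, and lifts to a map of resolutions of
    degree d. The case f = 1 is the comparison map between two resolutions of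
    the same ideal; the case of a monomial f gives the gluing map of a mapping
    cone. *)
Lemma chain_map_lift I L (F : gfree_resolution I) (G : gfree_resolution L)
    (f : {mpoly K[n]}) (d : int) :
    homogeneous_of d f -> (forall g, L g -> I (g * f)) ->
  exists phi : forall i, 'M[{mpoly K[n]}]_(arank G i, arank F i),
    [/\ phi 0 = f%:M,
        forall i, homog_mx (fun a => adeg a + d) (@adeg I F i) (phi i) &
        forall i, adiff G i *m phi i = phi i.+1 *m adiff F i].
Proof.
move=> hf Lf.
pose P i (A : 'M_(arank G i, arank F i)) :=
  homog_mx (fun a => adeg a + d) (@adeg I F i) A /\
  (forall a, exists w, row a (adiff G i *m A) = w *m adiff F i).
pose Q i (A : 'M_(arank G i, arank F i)) (B : 'M_(arank G i.+1, arank F i.+1)) :=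
  adiff G i *m A = B *m adiff F i.
suff [phi [phi0 phiS]] : exists phi : forall i, 'M_(arank G i, arank F i),
    phi 0 = f%:M /\ forall i, P i (phi i) /\ Q i (phi i) (phi i.+1).
  by exists phi; split=> // i; have [[h _] q] := phiS i; [exact: h | exact: q].
apply: dependent_choice; last first.
  move=> i A [hA liftA].
  have hGA : homog_mx (fun a => @adeg L G i.+1 a + d) (@adeg I F i)
      (adiff G i *m A).
    move=> a b.
    have := @homog_mxM _ _ _ _ _ (fun a => @adeg L G i.+1 a + d)
      (fun a => @adeg L G i a + d) (@adeg I F i) (adiff G i) A.
    apply=> // a' b'; have := @homog_adiff L G i a' b'.
    by congr (homogeneous_of _ _); ring.
  have [B hB eB] := homog_lift hGA (@homog_adiff I F i) liftA.
  exists B => //; split=> // a.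
  apply/adiff_exact; rewrite -row_mul -mulmxA -eB mulmxA adiff_comp mul0mx.
  exact: row0.
split=> [a b|a].
  by rewrite !ord1 mxE eqxx /= subr0 add0r.
have : I (row a (adiff G 0 *m f%:M) 0 0).
  rewrite mul_mx_scalar !mxE mulrC; apply: Lf.
  by apply/(faug_image G); exists (delta_mx 0 a); rewrite -rowE mxE.
move=> /(faug_image F) [w hw]; exists w; apply/rowP=> b; rewrite ord1.
by rewrite -hw.
Qed.

(** What remains of psi after subtracting the part of the homotopy already
    built is a cycle, hence a boundary, and a preimage of it is the next term.
    *)
Lemma null_homotopy I (F : gfree_resolution I)
    (psi : forall i, 'M[{mpoly K[n]}]_(arank F i)) :
    psi 0 = 0 ->
    (forall i, homog_mx (@adeg I F i) (@adeg I F i) (psi i)) ->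
    (forall i, adiff F i *m psi i = psi i.+1 *m adiff F i) ->
  exists h : forall i, 'M[{mpoly K[n]}]_(arank F i, arank F i.+1),
    [/\ h 0 = 0,
        forall i, homog_mx (@adeg I F i) (@adeg I F i.+1) (h i) &
        forall i, psi i.+1 = h i.+1 *m adiff F i.+1 + adiff F i *m h i].
Proof.
move=> psi0 hpsi cpsi.
pose P i (A : 'M_(arank F i, arank F i.+1)) :=
  homog_mx (@adeg I F i) (@adeg I F i.+1) A /\
  adiff F i *m (psi i - A *m adiff F i) = 0.
pose Q i (A : 'M_(arank F i, arank F i.+1))
    (B : 'M_(arank F i.+1, arank F i.+2)) :=
  psi i.+1 = B *m adiff F i.+1 + adiff F i *m A.
suff [h [h0 hS]] : exists h : forall i, 'M_(arank F i, arank F i.+1),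
    h 0 = 0 /\ forall i, P i (h i) /\ Q i (h i) (h i.+1).
  by exists h; split=> // i; have [[hh _] q] := hS i; [exact: hh | exact: q].
apply: dependent_choice; last first.
  move=> i A [hA cA]; rewrite /P /Q.
  have hB : homog_mx (@adeg I F i.+1) (@adeg I F i.+1)
      (psi i.+1 - adiff F i *m A).
    apply: homog_mxD => //; apply: homog_mxN.
    exact: homog_mxM (@homog_adiff I F i) hA.
  have [|B hB' eB] := homog_lift hB (@homog_adiff I F i.+1).
    move=> a; apply/(@adiff_exact I F i).
    by rewrite -row_mul mulmxBl -cpsi -mulmxA -mulmxBr cA row0.
  exists B; last by rewrite -eB subrK.
  split=> //; rewrite -eB opprB [_ - psi _]addrC addNKr mulmxA.
  by rewrite adiff_comp mul0mx.
split; last by rewrite psi0 mul0mx subr0 mulmx0.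
by move=> a b; rewrite mxE; apply: homogeneous0.
Qed.

End Comparison.

(** * Independence of Tor from the resolution *)

Section TorInvariance.
Local Open Scope ring_scope.
Context {K : fieldType} {n : nat}.
Implicit Types (I L : {mpoly K[n]} -> Prop).

(** The quotient Z / B embeds into Z' / B'. In terms of ranks: A has the same
    kernel on Z as on B, because an element of Z that A kills has its image in
    B' and so lies in B; and Z A meets B' only inside B A, for the same
    reason. *)
Lemma leq_rank_subquotient r s (Z B : 'M[K]_r) (Z' B' : 'M[K]_s)
    (A : 'M[K]_(r, s)) :
    (B <= Z)%MS -> (B' <= Z')%MS -> (Z *m A <= Z')%MS -> (B *m A <= B')%MS ->
    (forall v : 'rV_r, (v <= Z)%MS -> (v *m A <= B')%MS -> (v <= B)%MS) ->
  (\rank Z - \rank B <= \rank Z' - \rank B')%N.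
Proof.
move=> BZ BZ' ZA BA inj.
(* A kills only boundaries, so its kernels on Z and B coincide. *)
have kerE : (Z :&: kermx A <= B :&: kermx A)%MS.
  apply/rV_subP=> v; rewrite !sub_capmx => /andP [vZ /[dup] vk ->].
  rewrite andbT.
  by apply: inj => //; move: vk => /sub_kermxP ->; apply: sub0mx.
have capE : (Z *m A :&: B' <= B *m A)%MS.
  apply/rV_subP=> v; rewrite sub_capmx => /andP [/submxP [w ->] wB'].
  rewrite mulmxA in wB' *; apply: submxMr; apply: inj => //; exact: submxMl.
have e1 := mxrank_mul_ker Z A; have e2 := mxrank_mul_ker B A.
have e3 := mxrankS kerE; have e4 := mxrankS capE.
have e5 := mxrank_sum_cap (Z *m A) B'.
have e6 : (\rank (Z *m A + B') <= \rank Z')%N.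
  by apply: mxrankS; rewrite addsmx_sub ZA.
have e7 := mxrankS BZ; have e8 := mxrankS BZ'.
lia.
Qed.

Local Notation res := (map_mx (mcoeff 0%MM)).

(** A homogeneous matrix of degree 0 has a nonzero constant entry only between
    basis elements of equal degree, so after tensoring with K it commutes with
    the projections to the degree j parts. *)
Lemma deg_part_diag_comm r s (dr : 'I_r -> int) (ds : 'I_s -> int) j
    (A : 'M[{mpoly K[n]}]_(r, s)) :
  homog_mx dr ds A ->
  diag_mx (\row_b (dr b == j)%:R) *m res A =
  res A *m diag_mx (\row_b (ds b == j)%:R).
Proof.
move=> hA; apply/matrixP=> a b; rewrite mul_diag_mx mul_mx_diag !mxE.
have [->|neq] := eqVneq (dr a) (ds b); first by rewrite mulrC.
by rewrite (homogeneous_mcoeff0 (hA a b)) ?subr_eq0 // mulr0 mul0r.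
Qed.

Lemma sub_deg_partP I (F : gfree_resolution I) i j r
    (v : 'M[K]_(r, frank F i)) :
  reflect (v *m deg_part F i j = v) (v <= deg_part F i j)%MS.
Proof.
apply: (iffP idP) => [/submxP [w ->]|<-]; last exact: submxMl.
rewrite -mulmxA; congr (_ *m _); apply/matrixP=> a b.
by rewrite mul_diag_mx !mxE; case: eqP; rewrite ?mul1r ?mul0r ?mul0rn.
Qed.

Lemma sub_deg_part_mul I L (F : gfree_resolution I) (G : gfree_resolution L)
    i i' j r (v : 'M[K]_(r, frank F i))
    (A : 'M[{mpoly K[n]}]_(frank F i, frank G i')) :
  homog_mx (@gdeg _ _ _ F i) (@gdeg _ _ _ G i') A ->
  (v <= deg_part F i j)%MS -> (v *m res A <= deg_part G i' j)%MS.
Proof.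
move=> hA /sub_deg_partP hv; apply/sub_deg_partP.
by rewrite -{2}hv -!mulmxA (deg_part_diag_comm _ hA).
Qed.

Lemma res_mulmx r s t (A : 'M[{mpoly K[n]}]_(r, s)) (B : 'M_(s, t)) :
  res (A *m B) = res A *m res B.
Proof. exact: map_mxM. Qed.

Lemma rank_diag_indicator r (P : pred 'I_r) :
  \rank (diag_mx (\row_b (P b)%:R) : 'M[K]_r) = #|P|.
Proof.
set D := diag_mx _.
have rowD b : row b D = (P b)%:R *: delta_mx 0 b.
  by rewrite /D row_diag_mx mxE.
have -> : \rank D = \rank (\sum_(b | P b) <<delta_mx 0 b : 'rV[K]_r>>)%MS.
  apply/eqmx_rank/andP; split.
    apply/row_subP=> b; rewrite rowD; case Pb: (P b); last first.
      by rewrite scale0r sub0mx.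
    by rewrite scale1r; apply: (sumsmx_sup b); rewrite // genmxE.
  apply/sumsmx_subP => b Pb; rewrite genmxE -[delta_mx _ _]scale1r.
  by have := row_sub b D; rewrite rowD Pb.
have /mxdirectP /= -> := @mxdirect_delta K _ P r id (in2W (fun _ _ => id)).
by rewrite -sum1_card; apply: eq_bigr => b _; rewrite mxrank_gen mxrank_delta.
Qed.

Lemma tor_diff_sub_cycles I (F : gfree_resolution I) i :
  (tor_diff F i <= tor_cycles F i)%MS.
Proof.
case: i => [|i]; first exact: submx1.
apply/sub_kermxP; rewrite /tor_diff -res_mulmx (@adiff_comp _ _ I F i.+1).
exact: map_mx0.
Qed.

(** With comparison maps phi : F -> G and psi : G -> F and a homotopy h from 1
    to phi psi, a cycle z with z phi a boundary is z = (z - z phi psi) + z phi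
    psi, a sum of two boundaries; so phi is injective on homology. *)
Lemma leq_tor_dim I (F G : gfree_resolution I) i j :
  (tor_dim F i j <= tor_dim G i j)%N.
Proof.
have h1 : homogeneous_of (0 : int) (1 : {mpoly K[n]}).
  by move=> m; rewrite msupp1 inE => /eqP ->; rewrite mdeg0.
have I1 g : I g -> I (g * 1) by rewrite mulr1.
have [phi [phi0 hphi cphi]] := chain_map_lift G F h1 I1.
have [psi [psi0 hpsi cpsi]] := chain_map_lift F G h1 I1.
have {}hphi k : homog_mx (@adeg _ _ I F k) (@adeg _ _ I G k) (phi k).
  by move=> a b; have := hphi k a b; rewrite addr0.
have {}hpsi k : homog_mx (@adeg _ _ I G k) (@adeg _ _ I F k) (psi k).
  by move=> a b; have := hpsi k a b; rewrite addr0.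
have [||| h [h0 hh htpy]] :=
    @null_homotopy _ _ I F (fun k => 1%:M - phi k *m psi k).
- by rewrite phi0 psi0 -scalar_mxM mulr1 subrr.
- move=> k; apply: homog_mxD; first exact: homog_mx1.
  exact/homog_mxN/(homog_mxM (hphi k) (hpsi k)).
- move=> k; rewrite mulmxBr mulmxBl mulmx1 mul1mx mulmxA cphi.
  by rewrite -!mulmxA cpsi.
(* The term d h of the homotopy formula vanishes on cycles. In step 0 there is
   no incoming condition, but there h starts with the zero map. *)
have cyc0 (v : 'rV_(frank F i)) :
    (v <= tor_cycles F i)%MS -> v *m res (adiff F i) *m res (h i) = 0.
  case: (i) v => [|k] v; first by rewrite h0 map_mx0 mulmx0.
  by move=> /sub_kermxP /= ->; rewrite mul0mx.
apply: (@leq_rank_subquotient _ _ _ _ _ _ (res (phi i.+1))).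
- exact: capmxS (tor_diff_sub_cycles F i) (submx_refl _).
- exact: capmxS (tor_diff_sub_cycles G i) (submx_refl _).
- rewrite sub_capmx; apply/andP; split; last first.
    exact: sub_deg_part_mul (hphi i.+1) (capmxSr _ _).
  apply: submx_trans (submxMr _ (capmxSl _ _)) _.
  case: (i) => [|k] /=; first exact: submx1.
  apply/sub_kermxP; rewrite -mulmxA -res_mulmx -(cphi k.+1) res_mulmx mulmxA.
  by rewrite mulmx_ker mul0mx.
- rewrite sub_capmx; apply/andP; split; last first.
    exact: sub_deg_part_mul (hphi i.+1) (capmxSr _ _).
  apply: submx_trans (submxMr _ (capmxSl _ _)) _.
  by rewrite -res_mulmx (cphi i.+1) res_mulmx submxMl.
move=> v; rewrite !sub_capmx => /andP [vZ ->] /andP [/submxP [w hw] _].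
rewrite andbT.
have -> : v = v *m res (1%:M - phi i.+1 *m psi i.+1)
            + v *m res (phi i.+1) *m res (psi i.+1).
  by rewrite -mulmxA -res_mulmx -mulmxDr -map_mxD subrK map_mx1 mulmx1.
apply: addmx_sub; last first.
  rewrite hw -mulmxA -res_mulmx (cpsi i.+1) res_mulmx mulmxA.
  exact: submxMl.
rewrite htpy map_mxD !res_mulmx mulmxDr [X in _ + X]mulmxA cyc0 // addr0 mulmxA.
exact: submxMl.
Qed.

Lemma tor_dim_unique I (F G : gfree_resolution I) i j :
  tor_dim F i j = tor_dim G i j.
Proof. by apply/eqP; rewrite eqn_leq !leq_tor_dim. Qed.

(** The choice made by [betti] is harmless: every admissible value equals the
    one computed from F. *)
Lemma betti_tor_dim I (F : gfree_resolution I) (p : nat) j :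
  betti I p j = tor_dim F p j.
Proof.
rewrite /betti; set P := fun d => _.
have [G ->] : P (epsilon (inhabits 0%N) P).
  by apply: epsilon_spec; exists (tor_dim F p j), F.
exact: tor_dim_unique.
Qed.

(** Minimality is the vanishing of all differentials after tensoring with K; c
    i j is then the number of basis elements of degree j in step i. *)
Definition minimal_resolution_with I (c : nat -> int -> nat) :=
  exists F : gfree_resolution I, (forall i, tor_diff F i = 0) /\
    forall i j, #|[pred b : 'I_(frank F i) | gdeg b == j]| = c i j.

Lemma betti_minimal I c : minimal_resolution_with I c ->
  forall (p : nat) j, betti I p j = c p j.
Proof.
move=> [F [min cnt]] p j; rewrite (betti_tor_dim F) -cnt /tor_dim min cap0mx.
rewrite mxrank0 subn0.
have -> : \rank (tor_cycles F p :&: deg_part F p j)%MS = \rank (deg_part F p j).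
  apply/eqmx_rank/andP; split; first exact: capmxSr.
  rewrite sub_capmx submx_refl andbT; case: (p) => [|k]; first exact: submx1.
  by apply/sub_kermxP; rewrite min mulmx0.
exact: rank_diag_indicator.
Qed.

End TorInvariance.

(** * Mapping cones *)

Section MappingCone.
Local Open Scope ring_scope.
Context {K : fieldType} {n : nat}.
Implicit Types (I L J : {mpoly K[n]} -> Prop).

Lemma mulmxNN r s t (A : 'M[{mpoly K[n]}]_(r, s)) (B : 'M_(s, t)) :
  (- A) *m (- B) = A *m B.
Proof. rewrite mulNmx mulmxN; exact: opprK. Qed.

Definition sum_deg r s (dr : 'I_r -> int) (ds : 'I_s -> int) (b : 'I_(r + s)) :=
  match split b with inl a => dr a | inr a => ds a end.

Lemma sum_deg_l r s (dr : 'I_r -> int) (ds : 'I_s -> int) a :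
  sum_deg dr ds (lshift s a) = dr a.
Proof. by rewrite /sum_deg -[lshift _ _]/(unsplit (inl a)) unsplitK. Qed.

Lemma sum_deg_r r s (dr : 'I_r -> int) (ds : 'I_s -> int) a :
  sum_deg dr ds (rshift r a) = ds a.
Proof. by rewrite /sum_deg -[rshift _ _]/(unsplit (inr a)) unsplitK. Qed.

Lemma homog_row_mx r s1 s2 (dr : 'I_r -> int) (d1 : 'I_s1 -> int)
    (d2 : 'I_s2 -> int) (A : 'M[{mpoly K[n]}]_(r, s1)) (B : 'M_(r, s2)) :
  homog_mx dr d1 A -> homog_mx dr d2 B ->
  homog_mx dr (sum_deg d1 d2) (row_mx A B).
Proof.
move=> hA hB a b; rewrite -[b]splitK; case: (split b) => b' /=.
  by rewrite sum_deg_l row_mxEl.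
by rewrite sum_deg_r row_mxEr.
Qed.

Lemma homog_col_mx r1 r2 s (d1 : 'I_r1 -> int) (d2 : 'I_r2 -> int)
    (ds : 'I_s -> int) (A : 'M[{mpoly K[n]}]_(r1, s)) (B : 'M_(r2, s)) :
  homog_mx d1 ds A -> homog_mx d2 ds B ->
  homog_mx (sum_deg d1 d2) ds (col_mx A B).
Proof.
move=> hA hB a b; rewrite -[a]splitK; case: (split a) => a' /=.
  by rewrite sum_deg_l col_mxEu.
by rewrite sum_deg_r col_mxEd.
Qed.

Lemma card_sum_deg r s (dr : 'I_r -> int) (ds : 'I_s -> int) j :
  #|[pred b | sum_deg dr ds b == j]| =
  (#|[pred b | dr b == j]| + #|[pred b | ds b == j]|)%N.
Proof.
rewrite -!sum1_card big_split_ord; congr (_ + _)%N; apply: eq_bigl => b.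
  by rewrite !inE sum_deg_l.
by rewrite !inE sum_deg_r.
Qed.

Section Cone.
Variables (I L J : {mpoly K[n]} -> Prop).
Variables (F : gfree_resolution I) (G : gfree_resolution L).
Variables (f : {mpoly K[n]}) (d : int).
Variable phi : forall i, 'M[{mpoly K[n]}]_(arank G i, arank F i).
Hypothesis hf : homogeneous_of d f.
Hypothesis colon : forall g, L g <-> I (g * f).
Hypothesis sumJ : forall g, J g <-> exists g1 c, I g1 /\ g = g1 + c * f.
Hypothesis phi0 : phi 0 = f%:M.
Hypothesis homog_phi :
  forall i, homog_mx (fun a => adeg a + d) (@adeg _ _ I F i) (phi i).
Hypothesis phi_chain : forall i, adiff G i *m phi i = phi i.+1 *m adiff F i.

(** A step of the cone is the basis of F followed by the basis of the
    augmented complex of G one index lower, so that the element 1 of R in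
    index 0 of the latter stands for the new generator f. The sign on the
    differential of G makes consecutive differentials compose to zero. *)
Definition cone_diff i :
    'M_(frank F i.+1 + arank G i.+1, frank F i + arank G i) :=
  block_mx (fdiff F i) 0 (phi i.+1) (- adiff G i).

Definition cone_aug : 'cV_(frank F 0 + arank G 0) := col_mx (faug F) f%:M.

Definition cone_deg i : 'I_(frank F i + arank G i) -> int :=
  sum_deg (@gdeg _ _ _ F i) (fun a => @adeg _ _ _ G i a + d).

Lemma homog_cone_diff i a b :
  homogeneous_of (cone_deg a - cone_deg b) (cone_diff i a b).
Proof.
rewrite /cone_diff block_mxEv.
apply: (homog_col_mx (ds := @cone_deg i)); apply: homog_row_mx => {a b}.
- exact: fdiff_homog.
- by move=> a b; rewrite mxE; apply: homogeneous0.
- exact: homog_phi.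
apply: homog_mxN => a b; have := @homog_adiff _ _ L G i a b.
by congr (homogeneous_of _ _); ring.
Qed.

Lemma homog_cone_aug b : homogeneous_of (cone_deg b) (cone_aug b 0).
Proof.
rewrite -[cone_deg b]subr0.
apply: (homog_col_mx (ds := fun _ : 'I_1 => 0)) => a c.
  by rewrite subr0 ord1; apply: faug_homog.
by rewrite !ord1 mxE /= add0r subr0.
Qed.

(** If v2 = w2 dG, then v1 + w2 phi is a cycle of F: the relation between v1
    and v2 says so once phi is moved across dG. *)
Lemma cone_exact i (v1 : 'rV_(arank F i.+1)) (v2 : 'rV_(arank G i)) :
    (exists w, v2 = w *m adiff G i) -> v1 *m adiff F i + v2 *m phi i = 0 ->
  exists w, row_mx v1 v2 = w *m cone_diff i.
Proof.
move=> [w2 ->]; rewrite -mulmxA phi_chain mulmxA -mulmxDl.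
move=> /(@adiff_exact _ _ I F i) [w1 ew1]; exists (row_mx w1 (- w2)).
rewrite mul_row_block -[X in w1 *m X]/(adiff F i.+1) -ew1.
by rewrite mulmx0 add0r mulmxNN mulNmx addrK.
Qed.

Lemma cone_diff_comp i : cone_diff i.+1 *m cone_diff i = 0.
Proof.
rewrite mulmx_block !mul0mx !mulmx0 !addr0 !add0r mulmxNN.
rewrite (@adiff_comp _ _ I F i.+1) mulNmx -(phi_chain i.+1) subrr.
by rewrite adiff_comp; exact: block_mx0.
Qed.

Lemma cone_diff_aug : cone_diff 0 *m cone_aug = 0.
Proof.
rewrite mul_block_col mul0mx addr0 (@adiff_comp _ _ I F 0).
by rewrite mulNmx -phi0 phi_chain subrr col_mx0.
Qed.

Lemma cone_image g : J g <-> exists v : 'rV_(frank F 0 + arank G 0),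
  (v *m cone_aug) 0 0 = g.
Proof.
rewrite sumJ; split.
  move=> [g1 [c [/(faug_image F) [v1 <-] ->]]]; exists (row_mx v1 c%:M).
  by rewrite mul_row_col -scalar_mxM !mxE.
move=> [v <-]; rewrite -[v]hsubmxK mul_row_col.
exists ((lsubmx v *m faug F) 0 0), (rsubmx v 0 0); split.
  by apply/(faug_image F); exists (lsubmx v).
rewrite mxE; congr (_ + _).
by rewrite {1}[rsubmx v]mx11_scalar -scalar_mxM mxE.
Qed.

(** In index 0 the exactness on the side of G is the colon condition: if v1
    aug + c f = 0 then c f is in I, that is c is in L. *)
Lemma cone_exact0 (v : 'rV_(frank F 0 + arank G 0)) :
  v *m cone_aug = 0 <-> exists w, v = w *m cone_diff 0.
Proof.
split=> [|[w ->]]; last by rewrite -mulmxA cone_diff_aug mulmx0.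
rewrite -{1}[v]hsubmxK mul_row_col -phi0 => ev; rewrite -[v]hsubmxK.
apply: cone_exact => //.
have {}ev : rsubmx v 0 0 * f = - (lsubmx v *m faug F) 0 0.
  apply/eqP; rewrite -addr_eq0 addrC; apply/eqP.
  move/matrixP/(_ 0 0): ev; rewrite phi0 mul_mx_scalar mxE [X in _ + X = _]mxE.
  by rewrite mulrC => ->; rewrite mxE.
have /colon/(faug_image G) [w hw] : I (rsubmx v 0 0 * f).
  by apply/(faug_image F); exists (- lsubmx v); rewrite ev mulNmx mxE.
by exists w; apply/rowP=> b; rewrite ord1 -hw.
Qed.

Lemma cone_exactS i (v : 'rV_(frank F i.+1 + arank G i.+1)) :
  v *m cone_diff i = 0 <-> exists w, v = w *m cone_diff i.+1.
Proof.
split=> [|[w ->]]; last by rewrite -mulmxA cone_diff_comp mulmx0.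
rewrite -{1}[v]hsubmxK mul_row_block => ev.
have [ev1 ev2] := eq_row_mx (etrans ev (esym (row_mx0 _ _ _ _))).
rewrite -[v]hsubmxK; apply: cone_exact => //.
apply/(@adiff_exact _ _ L G i).
by move/eqP: ev2; rewrite mulmx0 add0r mulmxN oppr_eq0 => /eqP.
Qed.

Definition mapping_cone : gfree_resolution J :=
  GFreeResolution homog_cone_diff homog_cone_aug cone_image cone_exact0
    cone_exactS.

End Cone.

(** Ranks of the cone, with the single new generator of degree d in step 0. *)
Definition cone_betti (cF cG : nat -> int -> nat) (d : int) i j :=
  (cF i j + (if i is i'.+1 then cG i' (j - d)%R else (j - d == 0)%R : nat))%N.

(** Minimality is inherited when no basis element of G, shifted by d, has the
    degree of a basis element of F in the same step, and L is a proper ideal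
    (this is the meaning of cG 0 0 = 0): the first condition removes the
    constants from the gluing map and the second from the augmentation of G.
    *)
Lemma minimal_mapping_cone I L J (f : {mpoly K[n]}) (d : int) cF cG :
    homogeneous_of d f -> (forall g, L g <-> I (g * f)) ->
    (forall g, J g <-> exists g1 c, I g1 /\ g = g1 + c * f) ->
    minimal_resolution_with I cF -> minimal_resolution_with L cG ->
    cG 0%N 0 = 0%N -> (forall i j, cG i j != 0%N -> cF i (j + d) = 0%N) ->
  minimal_resolution_with J (cone_betti cF cG d).
Proof.
move=> hf colon sumJ [F [minF cntF]] [G [minG cntG]] cG0 sep.
have Lf g : L g -> I (g * f) by move/colon.
have [phi [phi0 hphi cphi]] := chain_map_lift F G hf Lf.
exists (mapping_cone hf colon sumJ phi0 hphi cphi); split=> i.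
  rewrite /tor_diff /= /cone_diff map_block_mx.
  have -> : map_mx (mcoeff 0%MM) (fdiff F i) = 0 by exact: minF.
  have -> : map_mx (mcoeff 0%MM) (phi i.+1) = 0.
    apply/matrixP=> a b; rewrite !mxE.
    apply: (homogeneous_mcoeff0 (hphi i.+1 a b)).
    rewrite subr_eq0; apply: contraT => /negPn /eqP /= eab.
    have : cG i (gdeg a) != 0%N.
      by rewrite -cntG -lt0n; apply/card_gt0P; exists a; rewrite inE.
    move=> /sep /eqP; rewrite -cntF -leqn0 leqNgt => /negP; case.
    by apply/card_gt0P; exists b; rewrite inE eab.
  have -> : map_mx (mcoeff 0%MM) (- adiff G i) = 0.
    rewrite map_mxN; case: i => [|i] /=; last first.
      by have := minG i; rewrite /tor_diff => ->; rewrite oppr0.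
    apply/matrixP=> a b; rewrite !mxE ord1.
    rewrite (homogeneous_mcoeff0 (@faug_homog _ _ _ G a)) ?oppr0 //.
    apply: contraT => /negPn /eqP ea; move/eqP: cG0.
    rewrite -cntG -leqn0 leqNgt => /negP; case.
    by apply/card_gt0P; exists a; rewrite inE ea.
  by rewrite map_mx0; exact: block_mx0.
move=> j; rewrite /= card_sum_deg cntF /cone_betti; congr (_ + _)%N.
case: i => [|i] /=; last first.
  by rewrite -cntG; apply: eq_card => a; rewrite !inE [RHS]eq_sym subr_eq eq_sym.
rewrite add0r [d == j]eq_sym -[j == d]subr_eq0; case: (j - d == 0).
  by rewrite eq_cardT ?size_enum_ord.
by apply: eq_card0.
Qed.

End MappingCone.

(** * Monomial ideals as divisibility conditions *)

Section MonomialSpan.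
Local Open Scope ring_scope.
Context {K : fieldType} {n : nat}.
Implicit Types (I J : {mpoly K[n]} -> Prop) (f g : {mpoly K[n]}).
Implicit Types (m M N : 'X_{1..n}) (s : seq 'X_{1..n}).

(** A polynomial lies in a monomial ideal exactly when each of its monomials
    is divisible by a generator. Membership and colons thereby become
    statements about exponent vectors. *)
Lemma ideal_of_monomialsP (S : 'X_{1..n} -> Prop) f :
  ideal_of_monomials S f <->
  (forall m, m \in msupp f -> exists2 M, S M & (M <= m)%MM).
Proof.
split=> [[r [c [M [SM ->]]]] m /msupp_sum_le /flatten_mapP [t _]|hf].
  move=> /msuppM_le /allpairsP [[m1 m2] /= [_ /mem_msuppXP <- ->]].
  by exists (M t); rewrite // lem_addl.
pose supp_f (t : 'I_(size (msupp f))) := nth 0%MM (msupp f) t.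
have hS t : {M | S M /\ (M <= supp_f t)%MM}.
  apply: constructive_indefinite_description.
  by have [|M SM leM] := hf (supp_f t); [apply: mem_nth | exists M].
exists (size (msupp f)), (fun t => f@_(supp_f t) *: 'X_[supp_f t - sval (hS t)]).
exists (fun t => sval (hS t)); split=> [t|]; first by case: (svalP (hS t)).
rewrite {1}[f]mpolyE (big_nth 0%MM) big_mkord; apply: eq_bigr => t _.
by rewrite -scalerAl -mpolyXD submK //; case: (svalP (hS t)).
Qed.

Definition divisible_by s m := has (fun M => M <= m)%MM s.

(** The ideal generated by a finite list of monomials, encoded through the
    divisibility criterion for membership. *)
Definition gen_ideal s f : Prop := all (divisible_by s) (msupp f).

Lemma divisible_by_le s m m' :
  (m <= m')%MM -> divisible_by s m -> divisible_by s m'.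
Proof.
move=> le /hasP [M sM leM]; apply/hasP; exists M => //; exact: lepm_trans leM le.
Qed.

Lemma gen_ideal_colon s (t : seq 'X_{1..n}) M :
    (forall m, divisible_by s (m + M) = divisible_by t m) ->
  forall f, gen_ideal t f <-> gen_ideal s (f * 'X_[M]).
Proof.
move=> colon f; rewrite /gen_ideal (perm_all _ (msuppMX f M)) (all_map (+%MM M)).
have /eq_all -> // : preim (+%MM M) (divisible_by s) =1 divisible_by t.
by move=> m /=; rewrite -colon addmC.
Qed.

Lemma gen_ideal_cons s M f :
  gen_ideal (M :: s) f <-> exists g c, gen_ideal s g /\ f = g + c * 'X_[M].
Proof.
split=> [/allP hf|[g [c [/allP hg ->]]]].
  exists (\sum_(m <- msupp f | divisible_by s m) f@_m *: 'X_[m]).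
  exists (\sum_(m <- msupp f | ~~ divisible_by s m) f@_m *: 'X_[m - M]).
  split.
    apply/allP => m; rewrite -big_filter => /msupp_sum_le /flatten_mapP [m'].
    rewrite filter_predT mem_filter => /andP [sm' _] /msuppZ_le.
    by move=> /mem_msuppXP <-.
  rewrite {1}[f]mpolyE (bigID (divisible_by s)) /=; congr (_ + _).
  rewrite mulr_suml big_seq_cond [RHS]big_seq_cond; apply: eq_bigr.
  move=> m /andP [/hf /= /orP [leM _|->]] //.
  by rewrite -scalerAl -mpolyXD submK.
apply/allP => m /msuppD_le; rewrite mem_cat => /orP [/hg sm|].
  by rewrite /divisible_by /= -/(divisible_by s m) sm orbT.
move=> /msuppM_le /allpairsP [[m1 m2] /= [_ /mem_msuppXP <- ->]].
by rewrite /divisible_by /= lem_addl.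
Qed.

Lemma minimal_resolution_ext I J c c' :
  (forall f, I f <-> J f) -> (forall i j, c i j = c' i j) ->
  minimal_resolution_with I c -> minimal_resolution_with J c'.
Proof.
move=> IJ cc' [F [minF cntF]].
have image f : J f <-> exists v : 'rV_(frank F 0), (v *m faug F) 0 0 = f.
  by rewrite -IJ; apply: faug_image.
exists (GFreeResolution (@fdiff_homog _ _ _ F) (@faug_homog _ _ _ F) image
  (@fexact0 _ _ _ F) (@fexactS _ _ _ F)); split=> [i|i j].
  exact: minF.
by rewrite -cc' -cntF.
Qed.

Lemma minimal_resolution_nil :
  minimal_resolution_with (gen_ideal [::]) (fun _ _ => 0%N).
Proof.
have v0 (R : nmodType) r (v w : 'M[R]_(r, 0)) : v = w by apply/matrixP => a [].
have image f : gen_ideal [::] f <->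
    exists v : 'rV_0, (v *m (0 : 'cV[{mpoly K[n]}]_0)) 0 0 = f.
  split=> [|[v <-]]; last by rewrite mulmx0 mxE /gen_ideal msupp0.
  rewrite /gen_ideal; case E: (msupp f) => [|m l] // _.
  by exists 0; rewrite mulmx0 mxE (msuppnil0 E).
exists (@GFreeResolution K n (gen_ideal [::]) (fun=> 0%N) (fun _ _ => 0)
  (fun _ => 0) 0 (fun i a b => match a with Ordinal _ p => ltac:(by []) end)
  (fun a => match a with Ordinal _ p => ltac:(by []) end) image
  (fun v => conj (fun _ => ex_intro _ 0 (v0 _ _ _ _)) (fun _ => mulmx0 _ _))
  (fun _ v => conj (fun _ => ex_intro _ 0 (v0 _ _ _ _)) (fun _ => v0 _ _ _ _))).
split=> [i|i j]; first exact: v0.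
by apply: eq_card0 => -[].
Qed.

Lemma minimal_resolution_cons s t M cF cG :
    (forall m, divisible_by s (m + M) = divisible_by t m) ->
    minimal_resolution_with (gen_ideal s) cF ->
    minimal_resolution_with (gen_ideal t) cG -> cG 0%N 0 = 0%N ->
    (forall i j, cG i j != 0%N -> cF i (j + mdeg M) = 0%N) ->
  minimal_resolution_with (gen_ideal (M :: s)) (cone_betti cF cG (mdeg M)).
Proof.
move=> colon; exact: (minimal_mapping_cone (@homogeneousX K n M)
  (gen_ideal_colon colon) (gen_ideal_cons s M)).
Qed.

Lemma divisible_by_vars (t : seq 'I_n) m :
  divisible_by [seq U_(l)%MM | l <- t] m = has (fun l => m l != 0%N) t.
Proof. by rewrite /divisible_by has_map; apply: eq_has => l; apply: lep1mP. Qed.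

(** This is the Koszul complex truncated at the ideal. For a new variable x_l
    the colon (x_t : x_l) is (x_t) again, so the truncated complex is glued to
    a shifted copy of itself, and Pascal's rule counts the ranks. *)
Lemma minimal_resolution_vars (t : seq 'I_n) : uniq t ->
  minimal_resolution_with (gen_ideal [seq U_(l)%MM | l <- t])
    (fun i j => 'C(size t, i.+1) * (j == i.+1 :> int))%N.
Proof.
elim: t => [_|l t IH /= /andP [lt ut]].
  exact: minimal_resolution_ext minimal_resolution_nil.
have colon m : divisible_by [seq U_(l)%MM | l <- t] (m + U_(l)) =
    divisible_by [seq U_(l)%MM | l <- t] m.
  rewrite !divisible_by_vars; apply: eq_in_has => l' tl'.
  rewrite mnmDE mnm1E; have [e|_] := eqVneq l l'; last by rewrite addn0.
  by rewrite e tl' in lt.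
have := minimal_resolution_cons colon (IH ut) (IH ut); rewrite muln0 mdeg1.
move=> /(_ erefl) cone.
apply: minimal_resolution_ext (cone _) => // i j; last lia.
rewrite /cone_betti; case: i => [|i]; rewrite [in RHS]binS ?bin0; lia.
Qed.

End MonomialSpan.

(** * Ideals with linear quotients *)

Section LinearQuotients.
Context {n : nat}.
Implicit Types (m M N : 'X_{1..n}) (S T : {set 'I_n}).
Implicit Types (s : seq 'X_{1..n}) (q : seq ('X_{1..n} * {set 'I_n})).

(** The colon ideal of s by M is generated by the variables indexed by S. *)
Definition colon_vars s M S :=
  forall m, divisible_by s (m + M) = [exists l in S, m l != 0].

(** The most recently adjoined generator is at the head of the list, so each
    entry is compared with the tail behind it. *)
Fixpoint linear_quotients q :=
  if q is x :: q' then
    colon_vars [seq y.1 | y <- q'] x.1 x.2 /\ linear_quotients q'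
  else True.

Definition antichain s := {in s &, forall M N, (M <= N)%MM -> M = N}.

(** The graded Betti numbers of an ideal with linear quotients: each generator
    M with colon set S contributes a shifted Koszul complex on S. *)
Definition lq_betti q (i : nat) (j : int) :=
  \sum_(x <- q) 'C(#|x.2|, i) * (j == Posz (i + mdeg x.1)).

Definition mdeg_geq (x y : 'X_{1..n} * {set 'I_n}) := mdeg y.1 <= mdeg x.1.

Lemma mdeg_geq_trans : transitive mdeg_geq.
Proof. by move=> y x z xy yz; apply: leq_trans yz xy. Qed.

Lemma divisible_by_eq s s' : s =i s' -> divisible_by s =1 divisible_by s'.
Proof. by move=> ss' m; apply: eq_has_r. Qed.

Lemma mnm_le_add2r M m m' : (m <= m')%MM -> (m + M <= m' + M)%MM.
Proof.
by move=> /mnm_lepP le; apply/mnm_lepP => i; rewrite !mnmDE leq_add2r.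
Qed.

Lemma mdeg_le M N : (M <= N)%MM -> mdeg M <= mdeg N.
Proof. by move=> le; rewrite -(submK le) mdegD leq_addl. Qed.

Lemma mnm_le_mdeg_eq M N : (M <= N)%MM -> mdeg N <= mdeg M -> M = N.
Proof.
move=> le; rewrite -{1}(submK le) mdegD -[X in _ <= X]add0n leq_add2r leqn0.
by rewrite mdeg_eq0 => /eqP e; rewrite -(submK le) e add0m.
Qed.

Lemma divisible_by_cons M s m :
  divisible_by (M :: s) m = (M <= m)%MM || divisible_by s m.
Proof. by []. Qed.

(** Suppose N comes just before M, has larger degree, and is not a multiple of
    M. The quotient N : M then has degree at least 2, so it is not one of the
    variables of the colon by M, and these all come from s. Conversely, if M
    divides m N, choose a variable x_l of the colon by M that divides N : M;
    then some P in s divides x_l M. The exponent of x_l in N exceeds the one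
    in M, so P divides m N too, and M adds nothing to the colon by N. *)
Lemma linear_quotients_swap M S N T s :
    colon_vars s N T -> colon_vars (N :: s) M S -> mdeg M < mdeg N ->
    ~~ (M <= N)%MM ->
  colon_vars s M S /\ colon_vars (M :: s) N T.
Proof.
move=> cN cM ltMN MN; have cM' : colon_vars s M S.
  move=> m; apply/idP/idP => [sm|]; first by rewrite -cM divisible_by_cons sm orbT.
  case/existsP => l /andP [Sl ml].
  have : divisible_by (N :: s) (U_(l) + M).
    by rewrite cM; apply/existsP; exists l; rewrite Sl mnm1E eqxx.
  rewrite divisible_by_cons => /orP [le|].
    have eN : N = (U_(l) + M)%MM.
      by apply: mnm_le_mdeg_eq => //; rewrite mdegD mdeg1.
    by rewrite eN lem_addl in MN.
  by apply: divisible_by_le; apply: mnm_le_add2r; rewrite lep1mP.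
split=> // m; rewrite divisible_by_cons -cN; apply: orb_idl => le.
have : divisible_by (N :: s) ((N - M) + M).
  rewrite divisible_by_cons; apply/orP; left; apply/mnm_lepP => i.
  by rewrite mnmDE mnmBE; lia.
rewrite cM => /existsP [l /andP [Sl]]; rewrite mnmBE subn_eq0 -ltnNge => ltl.
have : divisible_by s (U_(l) + M).
  by rewrite cM'; apply/existsP; exists l; rewrite Sl mnm1E eqxx.
apply: divisible_by_le; apply/mnm_lepP => i.
move/mnm_lepP/(_ i): le; rewrite !mnmDE mnm1E.
by case: eqP => [<-|_]; [lia | rewrite add0n].
Qed.

(** Insertion sort with the swap as elementary step; the sets S travel
    unchanged with their generators, which is why the Betti numbers depend
    only on the multiset of pairs. *)
Lemma linear_quotients_insert M S q :
    linear_quotients ((M, S) :: q) -> sorted mdeg_geq q ->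
    antichain [seq x.1 | x <- (M, S) :: q] ->
  exists q', [/\ perm_eq q' ((M, S) :: q), linear_quotients q' &
                 sorted mdeg_geq q'].
Proof.
elim: q => [|[N T] q IH]; first by exists [:: (M, S)].
move=> lq sq anti; have [leNM|ltMN] := leqP (mdeg N) (mdeg M).
  by exists [:: (M, S), (N, T) & q]; split=> //=; apply/andP; split.
have MN : ~~ (M <= N)%MM.
  apply/negP => /anti; rewrite !inE !eqxx orbT => /(_ isT isT) e.
  by rewrite e ltnn in ltMN.
case: lq => cM [cN lq]; have [cM' cN'] := linear_quotients_swap cN cM ltMN MN.
move: sq; rewrite /= (path_sortedE mdeg_geq_trans) => /andP [allq sq].
have [|//||q' [pq lq' sq']] := IH.
- by split.
- move=> A B qA qB; apply: anti; rewrite !inE in qA qB *.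
    by case/orP: qA => ->; rewrite ?orbT.
  by case/orP: qB => ->; rewrite ?orbT.
exists ((N, T) :: q'); split.
- apply: (@perm_trans _ [:: (N, T), (M, S) & q]); first by rewrite perm_cons.
  by apply/permP => p /=; rewrite addnCA.
- split=> // m; rewrite -cN'; apply: divisible_by_eq.
  exact: perm_mem (perm_map fst pq).
rewrite /= (path_sortedE mdeg_geq_trans) sq' andbT (perm_all _ pq) /= allq andbT.
exact: ltnW.
Qed.

Lemma linear_quotients_sort q :
    linear_quotients q -> antichain [seq x.1 | x <- q] ->
  exists q', [/\ perm_eq q' q, linear_quotients q' & sorted mdeg_geq q'].
Proof.
elim: q => [|[M S] q IH]; first by exists [::].
move=> [cM lq] anti; have [//||q1 [pq1 lq1 sq1]] := IH.
  by move=> A B qA qB; apply: anti; rewrite inE ?qA ?qB orbT.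
have [||//|q2 [pq2 lq2 sq2]] := @linear_quotients_insert M S q1.
- split=> // m; rewrite -cM; apply: divisible_by_eq.
  exact: perm_mem (perm_map fst pq1).
- exact: sq1.
- have pq : perm_eq ((M, S) :: q1) ((M, S) :: q) by rewrite perm_cons.
  by move=> A B; rewrite !(perm_mem (perm_map fst pq)); apply: anti.
exists q2; split=> //; apply: perm_trans pq2 _; by rewrite perm_cons.
Qed.

End LinearQuotients.

Section Resolution.
Local Open Scope ring_scope.
Context {K : fieldType} {n : nat}.
Implicit Types (I : {mpoly K[n]} -> Prop).

(** The colon by the new generator M is resolved linearly: its basis elements
    in step i have degree i + 1, hence i + 1 + deg M after the shift. Since
    the generators are sorted, degrees in step i of the previous resolution
    are at most i + deg M. Thus the cone is minimal. *)
Lemma linear_quotients_resolution (q : seq ('X_{1..n} * {set 'I_n})) :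
    linear_quotients q -> sorted mdeg_geq q ->
  minimal_resolution_with (gen_ideal (K := K) [seq x.1 | x <- q]) (lq_betti q).
Proof.
elim: q => [_ _|[M S] q IH [cM lq] sq].
  apply: minimal_resolution_ext minimal_resolution_nil => // i j.
  by rewrite /lq_betti big_nil.
move: sq; rewrite /= (path_sortedE (@mdeg_geq_trans n)) => /andP [/allP geM sq].
have colon m : divisible_by [seq x.1 | x <- q] (m + M) =
    divisible_by [seq U_(l)%MM | l <- enum S] m.
  rewrite cM divisible_by_vars; apply/existsP/hasP => -[l].
    by move=> /andP [Sl ml]; exists l; rewrite ?mem_enum.
  by rewrite mem_enum => Sl ml; exists l; rewrite Sl.
have := minimal_resolution_cons colon (IH lq sq)
  (minimal_resolution_vars (enum_uniq S)).
rewrite muln0 -cardE => /(_ erefl) cone.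
apply: minimal_resolution_ext (cone _) => // i j.
  rewrite /cone_betti /lq_betti big_cons addnC /=; congr (_ + _)%N.
  by case: i => [|i]; rewrite ?bin0 ?mul1n subr_eq PoszD.
rewrite muln_eq0 negb_or eqb0 negbK => /andP [_ /eqP ->].
rewrite /lq_betti big_seq big1 // => x qx.
by have := geM x qx; rewrite /mdeg_geq /=; case: eqP; lia.
Qed.

Definition presents I (q : seq ('X_{1..n} * {set 'I_n})) :=
  forall M, min_gen I M <-> M \in [seq x.1 | x <- q].

(** Induction on the degree: a monomial of I that is not a minimal generator
    has a proper divisor in I. *)
Lemma ex_min_gen I m : I 'X_[m] -> exists2 M, min_gen I M & (M <= m)%MM.
Proof.
have [d] := ubnP (mdeg m); elim: d m => // d IH m ltm Im.
case: (classic (min_gen I m)) => [|nmin]; first by exists m; rewrite ?lepm_refl.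
have [M' [IM' leM' neM']] : exists M', [/\ I 'X_[M'], (M' <= m)%MM & M' <> m].
  apply: NNPP => nex; apply: nmin; split=> // M' IM' leM'.
  by apply: NNPP => neM'; apply: nex; exists M'.
have [|//|M minM leM] := IH M'.
  apply: (@leq_trans (mdeg m)) => //; rewrite ltnNge.
  by apply/negP => /(mnm_le_mdeg_eq leM').
by exists M => //; apply: lepm_trans leM leM'.
Qed.

Lemma monomial_idealP I : monomial_ideal I -> forall f,
  I f <-> forall m, m \in msupp f -> exists2 M, min_gen I M & (M <= m)%MM.
Proof.
move=> [S IS] f; have IX M : S M -> I 'X_[M].
  move=> SM; apply/IS/ideal_of_monomialsP => m /mem_msuppXP <-.
  by exists M; rewrite ?lepm_refl.
rewrite IS ideal_of_monomialsP; split=> h m /h [M hM leM].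
  have [M' minM' leM'] := ex_min_gen (IX M hM).
  by exists M' => //; apply: lepm_trans leM' leM.
case: hM => IM _; have /IS/ideal_of_monomialsP/(_ M) [|M' SM' leM'] := IM.
  exact/mem_msuppXP.
by exists M' => //; apply: lepm_trans leM' leM.
Qed.

Lemma monomial_ideal_presented I q : monomial_ideal I -> presents I q ->
  forall f, I f <-> gen_ideal [seq x.1 | x <- q] f.
Proof.
move=> monI pq f; rewrite (monomial_idealP monI); split=> [h|/allP h m /h].
  by apply/allP => m /h [M /pq qM leM]; apply/hasP; exists M.
by move=> /hasP [M /pq qM leM]; exists M.
Qed.

Lemma presents_antichain I q : presents I q -> antichain [seq x.1 | x <- q].
Proof. by move=> pq M N /pq [IM _] /pq [_ minN] leMN; apply: minN. Qed.

(** Sorting the generators by degree makes the iterated mapping cone minimal,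
    and the sum of ranks does not see the order. *)
Lemma betti_linear_quotients I q :
    monomial_ideal I -> presents I q -> linear_quotients q ->
  forall (i : nat) j, betti I i j = lq_betti q i j.
Proof.
move=> monI pq lq i j.
have [q' [pqq' lq' sq']] := linear_quotients_sort lq (presents_antichain pq).
have -> : lq_betti q i j = lq_betti q' i j.
  by rewrite /lq_betti (perm_big _ pqq').
apply: betti_minimal.
apply: minimal_resolution_ext (linear_quotients_resolution lq' sq') => // f.
rewrite (monomial_ideal_presented monI pq) /gen_ideal.
by rewrite (eq_all (divisible_by_eq (perm_mem (perm_map fst pqq')))).
Qed.

End Resolution.

(** * Shedding monomials and the recursion *)

Section Shedding.
Context {K : fieldType} {n : nat}.
Implicit Types (I : {mpoly K[n]} -> Prop) (u M N m : 'X_{1..n}).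
Implicit Types (S V : {set 'I_n}) (q : seq ('X_{1..n} * {set 'I_n})).

(** A subset of the minimal generators of I minimally generates the ideal that
    it spans; this applies to both the upper and the lower ideal. *)
Lemma min_gen_restrict I (P : 'X_{1..n} -> Prop) M :
  min_gen (K := K) (ideal_of_monomials (fun N => min_gen I N /\ P N)) M <->
  min_gen I M /\ P M.
Proof.
set J := ideal_of_monomials _.
have JX N : J 'X_[N] <-> exists2 M', min_gen I M' /\ P M' & (M' <= N)%MM.
  rewrite /J ideal_of_monomialsP; split=> [h|h m /mem_msuppXP <- //].
  by apply: h; apply/mem_msuppXP.
split=> [[/JX [M' hM' leM'] minM]|hM].
  by rewrite -(minM M') //; apply/JX; exists M'; rewrite ?lepm_refl.
split=> [|N /JX [M' [[IM' _] _] leM'] leN].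
  by apply/JX; exists M; rewrite ?lepm_refl.
apply: mnm_le_mdeg_eq => //; apply: mdeg_le.
case: hM => -[_ minM] _.
by rewrite -(minM M' IM' (lepm_trans leM' leN)).
Qed.

Lemma pow_var_le i e M : (U_(i) *+ e <= M)%MM = (e <= M i).
Proof.
apply/mnm_lepP/idP => [/(_ i)|le j]; rewrite mulmnE mnm1E.
  by rewrite eqxx mul1n.
by have [<-|_] := eqVneq i j; rewrite ?mul1n.
Qed.

Lemma bracket_eq1P u M :
  reflect (forall i, i \in supp u -> M i < u i) (bracket_eq1 u M).
Proof.
by apply: (iffP forall_inP) => h i /h; rewrite pow_var_le -ltnNge.
Qed.

(** Let N be the generator of the upper ideal with N : M = x_l. At some i in
    supp u the exponent of N reaches u i and that of M does not, so x_i
    divides N : M and i = l. Since N exceeds M by exactly 1 there, the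
    exponent of M is one less than u l. *)
Lemma shedding_colon_le I u M l :
    shedding_monomial u I -> min_gen (ideal_lower u I) M -> l \in supp u ->
  (M l).+1 = u l /\ exists2 N, min_gen (ideal_upper u I) N & (N <= U_(l) + M)%MM.
Proof.
move=> [_ shed] lowM ul; have [N upN colonN] := shed M l lowM ul.
have colE i : N i - minn (N i) (M i) = (l == i).
  by move/mnmP/(_ i): colonN; rewrite mnmBE mnmE mnm1E.
have /min_gen_restrict [_ /bracket_eq1P ltM] := lowM.
have /min_gen_restrict [_ /forall_inPn /= [i ui]] := upN.
rewrite negbK pow_var_le; have := ltM i ui; have := colE i.
have [<-|_] /= := eqVneq l i; last by lia.
move=> ei lti lei; split; first by lia.
by exists N => //; apply/mnm_lepP => k; rewrite mnmDE mnm1E -colE; lia.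
Qed.

(** A generator of the upper ideal has some exponent at least u l where a
    generator of the lower ideal stays below, so x_l must divide the cofactor.
    *)
Lemma upper_colon_lower I u M N m :
    min_gen (ideal_lower u I) M -> min_gen (ideal_upper u I) N ->
    (N <= m + M)%MM ->
  exists2 l, l \in supp u & m l != 0.
Proof.
move=> /min_gen_restrict [_ /bracket_eq1P ltM].
move=> /min_gen_restrict [_ /bracket_eq1P ltN] /mnm_lepP le.
have [l] : exists l, (l \in supp u) && (u l <= N l).
  apply/existsP; rewrite -[X in is_true X]negbK negb_exists.
  apply/negP => /forallP h.
  apply: ltN => l ul; have := h l; rewrite ul /= -ltnNge //.
move=> /andP [ul leN]; exists l => //; have := le l; rewrite mnmDE.
by have := ltM l ul; lia.
Qed.

(** Appending an earlier block q2 enlarges every colon of q1 by (q2 : x),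
    which is the same ideal of variables V for all x in q1. *)
Lemma linear_quotients_cat q1 q2 V :
    linear_quotients q1 -> linear_quotients q2 ->
    (forall x, x \in q1 -> colon_vars [seq y.1 | y <- q2] x.1 V) ->
  linear_quotients ([seq (x.1, x.2 :|: V) | x <- q1] ++ q2).
Proof.
move=> + lq2; elim: q1 => [//|[M S] q1 IH] /= [cM lq1] cV; split.
  move=> m; rewrite map_cat /divisible_by has_cat -!/(divisible_by _ _) -map_comp.
  rewrite (eq_map (_ : _ =1 fst)) // cM (cV (M, S)) ?inE ?eqxx //=.
  apply/orP/existsP => [[]/existsP [l /andP [Sl ml]]|[l]].
  - by exists l; rewrite inE Sl.
  - by exists l; rewrite inE Sl orbT.
  rewrite inE => /andP [/orP [Sl|Vl] ml].
    by left; apply/existsP; exists l; rewrite Sl.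
  by right; apply/existsP; exists l; rewrite Vl.
by apply: IH => // x q1x; apply: cV; rewrite inE q1x orbT.
Qed.

(** If x_l with l in V were in the colon by M, an earlier generator N would
    divide x_l M; as N and M agree at l, N would divide M, which a colon
    generated by variables excludes. *)
Lemma linear_quotients_disjoint q V :
    linear_quotients q ->
    (forall x y l, x \in q -> y \in q -> l \in V -> x.1 l = y.1 l) ->
  forall x, x \in q -> [disjoint x.2 & V].
Proof.
elim: q => [//|[M S] q IH] /= [cM lq] eV x; rewrite inE => /orP [/eqP ->|qx].
  apply/pred0P => l /=; apply/negP => /andP [Sl Vl].
  have : divisible_by [seq y.1 | y <- q] (U_(l) + M).
    by rewrite cM; apply/existsP; exists l; rewrite Sl mnm1E eqxx.
  move=> /hasP [_ /mapP [y qy ->] /mnm_lepP le].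
  have : divisible_by [seq y.1 | y <- q] (0 + M).
    apply/hasP; exists y.1; first exact: map_f.
    rewrite add0m; apply/mnm_lepP => k; have := le k; rewrite mnmDE mnm1E.
    case: eqP => [<-|_] // _; rewrite (eV y (M, S)) // inE ?qy ?eqxx ?orbT //.
  by rewrite cM => /existsP [k]; rewrite mnm0E andbF.
apply: IH => // y z l qy qz Vl; by apply: eV; rewrite // inE ?qy ?qz orbT.
Qed.

(** Only the colons by generators of the lower ideal grow when the upper ideal
    is placed before them. The growth is disjoint from what was there, because
    these generators all have the same exponents on supp u. *)
Lemma shedding_presents I u qL qU :
    shedding_monomial u I ->
    presents (ideal_lower u I) qL -> linear_quotients qL ->
    presents (ideal_upper u I) qU -> linear_quotients qU ->
  [/\ presents I ([seq (x.1, x.2 :|: supp u) | x <- qL] ++ qU),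
      linear_quotients ([seq (x.1, x.2 :|: supp u) | x <- qL] ++ qU) &
      forall x, x \in qL -> [disjoint x.2 & supp u]].
Proof.
move=> shed presL lqL presU lqU.
have low x : x \in qL -> min_gen (ideal_lower u I) x.1.
  by move=> qx; apply/presL/map_f.
split.
- move=> M; rewrite map_cat mem_cat -map_comp (eq_map (_ : _ =1 fst)) //.
  have [lowM|lowM] := boolP (bracket_eq1 u M).
    split=> [minM|/orP [/presL|/presU] /min_gen_restrict [] //].
    by apply/orP; left; apply/presL/min_gen_restrict.
  split=> [minM|/orP [/presL|/presU] /min_gen_restrict [] //].
  by apply/orP; right; apply/presU/min_gen_restrict.
- apply: linear_quotients_cat => // x /low lowx m.
  apply/hasP/existsP => [[N /presU upN /(upper_colon_lower lowx upN)]|[l]].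
    by move=> [l ul ml]; exists l; rewrite ul.
  move=> /andP [ul ml].
  have [_ [N /presU upN le]] := shedding_colon_le shed lowx ul.
  exists N => //; apply: lepm_trans le _.
  by apply: mnm_le_add2r; rewrite lep1mP.
apply: linear_quotients_disjoint => // x y l /low lowx /low lowy ul.
have [ex _] := shedding_colon_le shed lowx ul.
have [ey _] := shedding_colon_le shed lowy ul.
by apply: succn_inj; rewrite ex ey.
Qed.

Lemma k_decomposable_linear_quotients k I :
  k_decomposable k I -> exists2 q, presents I q & linear_quotients q.
Proof.
elim=> {I} [I monI [M0 hM0]|I u monI shed _ _ [qL presL lqL] _ [qU presU lqU]].
  exists [:: (M0, set0)] => [M|]; first by rewrite hM0 /= inE; split=> /eqP.
  split=> // m; rewrite /divisible_by /=; apply/esym/existsP => -[l].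
  by rewrite inE.
by have [pI lqI _] := shedding_presents shed presL lqL presU lqU; eexists; eauto.
Qed.

(** Vandermonde's identity, summed over the range of the lower index d instead
    of that of i. *)
Lemma Vandermonde_shift c d i :
  'C(c + d, i) = \sum_(l < d.+1) 'C(d, l) * (if l <= i then 'C(c, i - l) else 0).
Proof.
pose F l := 'C(d, l) * (if l <= i then 'C(c, i - l) else 0).
have trunc a b : a <= b -> (forall l, a <= l -> F l = 0) ->
    \sum_(l < a) F l = \sum_(l < b) F l.
  move=> leab F0; rewrite (big_ord_widen b F leab) big_mkcond /=.
  by apply: eq_bigr => l _; case: ltnP => // /F0.
have F0 l : (d < l) || (i < l) -> F l = 0.
  rewrite /F => /orP [/bin_small ->|]; first by [].
  by rewrite ltnNge => /negPf ->; rewrite muln0.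
rewrite -/F (trunc d.+1 (d + i).+1) ?ltnS ?leq_addr //; last first.
  by move=> l ltl; rewrite F0 // ltl.
rewrite -(trunc i.+1 (d + i).+1) ?ltnS ?leq_addl //; last first.
  by move=> l ltl; rewrite F0 // ltl orbT.
rewrite addnC -binomial.Vandermonde; apply: eq_bigr => l _; rewrite /F.
by have := ltn_ord l; rewrite ltnS => ->.
Qed.

Lemma lq_betti_cat q1 q2 i j :
  lq_betti (q1 ++ q2) i j = lq_betti q1 i j + lq_betti q2 i j.
Proof. by rewrite /lq_betti big_cat. Qed.

(** Enlarging every colon set by V amounts to tensoring with the Koszul
    complex on V; numerically, it is Vandermonde's identity for each
    generator. *)
Lemma lq_betti_disjoint q V (i : nat) (j : int) :
    (forall x, x \in q -> [disjoint x.2 & V]) ->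
  lq_betti [seq (x.1, x.2 :|: V) | x <- q] i j =
  \sum_(l < #|V|.+1) 'C(#|V|, l) *
    (if l <= i then lq_betti q (i - l) (j - l%:Z)%R else 0).
Proof.
move=> dis; rewrite {1}/lq_betti big_map.
have lowE (l : nat) :
    'C(#|V|, l) * (if l <= i then lq_betti q (i - l) (j - l%:Z)%R else 0) =
    \sum_(x <- q) 'C(#|V|, l) * (if l <= i then 'C(#|x.2|, i - l) else 0)
      * (j == Posz (i + mdeg x.1)).
  case: leqP => leli; last by rewrite muln0 big1 // => x _; rewrite muln0.
  rewrite /lq_betti big_distrr /=; apply: eq_bigr => x _; rewrite mulnA.
  by congr (_ * nat_of_bool _); lia.
under [RHS]eq_bigr do rewrite lowE.
rewrite exchange_big /= big_seq [RHS]big_seq; apply: eq_bigr => x qx.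
rewrite cardsU (disjoint_setI0 (dis x qx)) cards0 subn0 Vandermonde_shift.
by rewrite big_distrl.
Qed.

End Shedding.

Theorem theorem2p4 (K : fieldType) (n k : nat) (I : {mpoly K[n]} -> Prop)
    (u : 'X_{1..n}) :
  monomial_ideal I ->
  k_decomposable k I ->
  shedding_monomial u I ->
  (#|supp u| <= k.+1)%N ->
  k_decomposable k (ideal_lower u I) ->
  k_decomposable k (ideal_upper u I) ->
  forall i j : int,
    betti I i j =
      (betti (ideal_upper u I) i j +
       \sum_(l < #|supp u|.+1)
         'C(#|supp u|, l) *
           betti (ideal_lower u I) (i - l%:Z)%R (j - l%:Z)%R)%N.
Proof.
move=> monI _ shed _ /k_decomposable_linear_quotients [qL presL lqL].
move=> /k_decomposable_linear_quotients [qU presU lqU] i j.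
have [presI lqI dis] := shedding_presents shed presL lqL presU lqU.
have monL : monomial_ideal (ideal_lower u I) by eexists => f; apply: iff_refl.
have monU : monomial_ideal (ideal_upper u I) by eexists => f; apply: iff_refl.
case: i => i; last first.
  rewrite big1 // => l _.
  have -> : (Negz i - l%:Z)%R = Negz (i + l) by rewrite !NegzE; lia.
  exact: muln0.
rewrite (betti_linear_quotients monI presI lqI).
rewrite (betti_linear_quotients monU presU lqU) lq_betti_cat addnC.
rewrite lq_betti_disjoint //; congr (_ + _); apply: eq_bigr => l _.
congr (_ * _); case: leqP => leli.
  have -> : (i%:Z - l%:Z)%R = (i - l)%N by lia.
  by rewrite (betti_linear_quotients monL presL lqL).
by have -> : (i%:Z - l%:Z)%R = Negz (l - i).-1 by rewrite NegzE; lia.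
Qed.
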